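(* For every $\mu\in\mathrm{Prob}(\mathcal{X}^n)$ with marginals $\mu_1,\dots,\mu_n\in\mathrm{Prob}(\mathcal{X})$, $$\mathcal{I}_\mathrm{sym}(\mu)=I_\mathrm{sym}(\mu)=-S(\mu)+\sum_{i=1}^nS(\mu_i).$$
   Context: $\mathcal{X}=\{t_1,\dots,t_d\}$ is a finite set with a fixed order $t_1<\dots<t_d$; $n\in\mathbb{N}$. $\mathrm{Prob}(\mathcal{X}^k)$ is the set of probability measures on $\mathcal{X}^k$, $C_\mathbb{R}(\mathcal{X}^n)$ the real functions on $\mathcal{X}^n$; $\mu(h)=\sum_\mathbf{x}h(\mathbf{x})\mu(\mathbf{x})$; $\mu_i$ is the $i$th marginal. Shannon entropy: $S(\mu)=-\sum_t\mu(t)\log\mu(t)$. For a sequence $\mathbf{x}=(x_1,\dots,x_N)$ over a finite set $A$ (here $A=\mathcal{X}$ or $\mathcal{X}^n$), its type is $\nu_\mathbf{x}(t)=\#\{j:x_j=t\}/N$, $t\in A$; for $\mu\in\mathrm{Prob}(A)$, $\Delta(\mu;N,\delta)$ is the set of $\mathbf{x}\in A^N$ with $|\nu_\mathbf{x}(t)-\mu(t)|<\delta$ for all $t\in A$; an $n$-tuple $(\mathbf{x}_1,\dots,\mathbf{x}_n)\in(\mathcal{X}^N)^n$ is identified with the sequence $((x_{1j},\dots,x_{nj}))_{j=1}^N\in(\mathcal{X}^n)^N$. $\mathcal{X}_\le^N$ is the set of sequences in $\mathcal{X}^N$ of the form $(t_1,\dots,t_1,\dots,t_d,\dots,t_d)$.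 $S_N$ acts by $\sigma(\mathbf{x})=(x_{\sigma^{-1}(1)},\dots,x_{\sigma^{-1}(N)})$; $\gamma_{S_N}$ is uniform probability on $S_N$. An approximating sequence for $(\mu_1,\dots,\mu_n)$ is $\Xi(N)=(\xi_1(N),\dots,\xi_n(N))$ with $\xi_i(N)\in\mathcal{X}_\le^N$ and $\nu_{\xi_i(N)}(t)\to\mu_i(t)$ for all $t$. $\Delta_\mathrm{sym}(\mu:\Xi(N);N,\delta)$ is the set of $(\sigma_1,\dots,\sigma_n)\in S_N^n$ with $(\sigma_1(\xi_1(N)),\dots,\sigma_n(\xi_n(N)))\in\Delta(\mu;N,\delta)$, and $I_\mathrm{sym}(\mu)=-\lim_{\delta\searrow0}\limsup_{N\to\infty}\frac1N\log\gamma_{S_N}^{\otimes n}(\Delta_\mathrm{sym}(\mu:\Xi(N);N,\delta))$. For $h\in C_\mathbb{R}(\mathcal{X}^n)$, $\kappa_N(h(\mathbf{x}_1,\dots,\mathbf{x}_n))=\frac1N\sum_{j=1}^Nh(x_{1j},\dots,x_{nj})$, the mutual pressure is $$P_\mathrm{sym}(h:\mu_1,\dots,\mu_n)=\limsup_{N\to\infty}\frac1N\log\Biggl[\frac1{(N!)^n}\sum_{\sigma_1,\dots,\sigma_n\in S_N}\exp\bigl(N\kappa_N(h(\sigma_1(\xi_1(N)),\dots,\sigma_n(\xi_n(N))))\bigr)\Biggr],$$ and $\mathcal{I}_\mathrm{sym}(\mu)=\sup\{\mu(h)-P_\mathrm{sym}(h:\mu_1,\dots,\mu_n):h\in C_\mathbb{R}(\mathcal{X}^n)\}$.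 These do not depend on the approximating sequence. *)

(* Defs.v *)
From Stdlib Require Import Reals.
From mathcomp Require Import all_boot all_fingroup.

Set Implicit Arguments.
Unset Strict Implicit.
Unset Printing Implicit Defensive.

Local Open Scope R_scope.

(* The finite alphabet X = {t_1 < ... < t_d} is modelled as 'I_d with its
   natural order.  X^n is modelled as functions 'I_n -> 'I_d. *)
Definition Xn (d n : nat) := {ffun 'I_n -> 'I_d}.

Definition Rsum {T : finType} (F : T -> R) : R := \big[Rplus/0]_(x : T) F x.

Definition is_prob {T : finType} (p : T -> R) : Prop :=
  (forall x, 0 <= p x) /\ Rsum p = 1.

Definition expect {T : finType} (mu : T -> R) (h : T -> R) : R :=
  Rsum (fun x => h x * mu x).

Definition marginal (d n : nat) (mu : Xn d n -> R) (i : 'I_n) (t : 'I_d) : R :=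
  \big[Rplus/0]_(x : Xn d n | x i == t) mu x.

(* Shannon entropy; note Stdlib's ln 0 = 0, so 0 log 0 = 0 as usual *)
Definition entropy {T : finType} (p : T -> R) : R :=
  - Rsum (fun t => p t * ln (p t)).

Definition seq_type {A : finType} (N : nat) (x : {ffun 'I_N -> A}) (t : A) : R :=
  INR #|[pred j | x j == t]| / INR N.

Definition Rltb (x y : R) : bool := if Rlt_dec x y then true else false.

Definition in_Delta {A : finType} (mu : A -> R) (N : nat) (delta : R)
  (x : {ffun 'I_N -> A}) : bool :=
  [forall t, Rltb (Rabs (seq_type x t - mu t)) delta].

Definition sorted_seq (d N : nat) (x : {ffun 'I_N -> 'I_d}) : Prop :=
  forall j j' : 'I_N, (j <= j')%N -> (x j <= x j')%N.

Definition permute {A : Type} (N : nat) (s : 'S_N) (x : {ffun 'I_N -> A})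
  : {ffun 'I_N -> A} := [ffun j => x ((s^-1)%g j)].

Definition joint (d n N : nat) (xs : 'I_n -> {ffun 'I_N -> 'I_d})
  : {ffun 'I_N -> Xn d n} := [ffun j => [ffun i => xs i j]].

Definition approximating (d n : nat) (mu : Xn d n -> R)
  (Xi : forall N : nat, 'I_n -> {ffun 'I_N -> 'I_d}) : Prop :=
  (forall N i, sorted_seq (Xi N i)) /\
  (forall i t, Un_cv (fun N => seq_type (Xi N i) t) (marginal mu i t)).

Definition perm_joint (d n : nat) (Xi : forall N : nat, 'I_n -> {ffun 'I_N -> 'I_d})
  (N : nat) (sig : {ffun 'I_n -> 'S_N}) : {ffun 'I_N -> Xn d n} :=
  joint (fun i => permute (sig i) (Xi N i)).

Definition gamma_Delta_sym (d n : nat) (mu : Xn d n -> R)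
  (Xi : forall N : nat, 'I_n -> {ffun 'I_N -> 'I_d}) (N : nat) (delta : R) : R :=
  INR #|[pred sig : {ffun 'I_n -> 'S_N} | in_Delta mu delta (perm_joint Xi sig)]|
  / (INR (N`!) ^ n).

(* Reals extended by -infinity (needed since log 0 = -infinity) *)
Inductive ER : Type := Fin (r : R) | NInf.

Definition ER_lt_R (u : ER) (c : R) : Prop :=
  match u with Fin r => r < c | NInf => True end.
Definition R_lt_ER (c : R) (u : ER) : Prop :=
  match u with Fin r => c < r | NInf => False end.

Definition limsup_is (u : nat -> ER) (l : R) : Prop :=
  forall eps, 0 < eps ->
    (exists M, forall N, (M <= N)%nat -> ER_lt_R (u N) (l + eps)) /\
    (forall M, exists N, (M <= N)%nat /\ R_lt_ER (l - eps) (u N)).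

Definition ERln (x : R) : ER := if Rltb 0 x then Fin (ln x) else NInf.

Definition rate_sym (d n : nat) (mu : Xn d n -> R)
  (Xi : forall N : nat, 'I_n -> {ffun 'I_N -> 'I_d}) (delta : R) (N : nat) : ER :=
  match ERln (gamma_Delta_sym mu Xi N delta) with
  | Fin r => Fin (/ INR N * r)
  | NInf => NInf
  end.

Definition Isym_is (d n : nat) (mu : Xn d n -> R)
  (Xi : forall N : nat, 'I_n -> {ffun 'I_N -> 'I_d}) (v : R) : Prop :=
  forall eps, 0 < eps -> exists eta, 0 < eta /\
    forall delta, 0 < delta < eta ->
      exists L, limsup_is (rate_sym mu Xi delta) L /\ Rabs (- L - v) < eps.

Definition kappa (d n N : nat) (h : Xn d n -> R) (x : {ffun 'I_N -> Xn d n}) : R :=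
  / INR N * Rsum (fun j : 'I_N => h (x j)).

Definition pressure_term (d n : nat)
  (Xi : forall N : nat, 'I_n -> {ffun 'I_N -> 'I_d}) (h : Xn d n -> R) (N : nat) : R :=
  / INR N * ln (/ (INR (N`!) ^ n) *
     Rsum (fun sig : {ffun 'I_n -> 'S_N} =>
             exp (INR N * kappa h (perm_joint Xi sig)))).

Definition Psym_is (d n : nat)
  (Xi : forall N : nat, 'I_n -> {ffun 'I_N -> 'I_d}) (h : Xn d n -> R) (P : R) : Prop :=
  limsup_is (fun N => Fin (pressure_term Xi h N)) P.

Definition calIsym_is (d n : nat) (mu : Xn d n -> R)
  (Xi : forall N : nat, 'I_n -> {ffun 'I_N -> 'I_d}) (v : R) : Prop :=
  is_lub (fun y => exists (h : Xn d n -> R) (P : R),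
             Psym_is Xi h P /\ y = expect mu h - P) v.

(* Main.v *)
Require Import Defs.
From HB Require Import structures.
From Stdlib Require Import Reals Lra ZArith Classical.
From mathcomp Require Import all_boot all_fingroup.

Set Implicit Arguments.
Unset Strict Implicit.
Unset Printing Implicit Defensive.

(** Write [V = - S(mu) + sum_i S(mu_i)].  The stabilizer of a sequence in [S_N] is
    a Young subgroup, so by a crude Stirling bound its index is [exp (N S + o(N))],
    where [S] is the entropy of the type; hence each joint sequence in the support of
    the random rearrangement has probability [exp (- N sum_i S(mu_i) + o(N))].

    Summing [exp (N kappa_N h)] over all joint sequences gives
    [P_sym h <= ln (sum_a exp (h a)) - sum_i S(mu_i)].  Taking for [h] the logarithm
    of a slight mixture of [mu] with the uniform law yields the lower bound [V] for
    the Legendre transform and, through [exp (N mu(h)) gamma(Delta) <~ exp (N P_sym h)],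
    for [I_sym].

    Conversely, [floor (N (1 - e) mu(a))] copies of each letter [a] can be completed
    to a joint sequence with exactly the prescribed marginal types; its [S_N]-orbit
    has [exp (N S(mu) + o(N))] elements, all in [Delta], so [I_sym <= V], and the
    same Chebyshev inequality gives [mu(h) - P_sym h <= V] for every [h]. *)

(** * Counting rearrangements *)

Definition nocc (A : finType) (N : nat) (x : {ffun 'I_N -> A}) (a : A) : nat :=
  #|[pred j | x j == a]|.

Definition nstab (A : finType) (N : nat) (x : {ffun 'I_N -> A}) : nat :=
  #|[set s : 'S_N | permute s x == x]|.

Section PermuteAction.
Local Open Scope group_scope.
Variables (N : nat) (A : finType).
Implicit Types (x y : {ffun 'I_N -> A}) (s t : 'S_N) (l : seq A).

Lemma permute1 x : permute 1 x = x.
Proof. by apply/ffunP => j; rewrite ffunE invg1 perm1. Qed.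

Lemma permuteM x s t : permute (s * t) x = permute t (permute s x).
Proof. by apply/ffunP => j; rewrite !ffunE invMg permM. Qed.

Definition permute_action :=
  @TotalAction _ _ (fun x s => permute s x) permute1 permuteM.

(** These subgroups interpolate between the trivial group, at [l = [::]], and the full stabilizer of
    [x], when [l] lists all letters, so the stabilizer can be counted by induction on [l]. *)
Definition young x l : {set 'S_N} :=
  [set s : 'S_N | [forall j, (x (s j) == x j) && ((x j \in l) || (s j == j))]].

Lemma card_young x l : uniq l -> #|young x l| = (\prod_(a <- l) (nocc x a)`!)%N.
Proof.
elim: l => [|a l IHl] /= => [_|/andP[al /IHl {}IHl]].
  rewrite big_nil -(cards1 (1 : 'S_N)); apply: eq_card => s.
  rewrite !inE; apply/forallP/eqP => [sP|-> j]; last by rewrite perm1 !eqxx.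
  by apply/permP => j; rewrite perm1; have /andP[_ /eqP] := sP j.
pose F := [set j | x j == a].
have nF : nocc x a = #|F| by apply: eq_card => j; rewrite !inE.
have -> : (\prod_(b <- a :: l) (nocc x b)`!)%N =
          #|setX (young x l) [set s | perm_on F s]|.
  by rewrite big_cons mulnC -IHl nF cardsX -card_perm; congr (_ * _)%N;
     apply: eq_card => s; rewrite inE.
(* Each element of the larger group splits as [u * v], where [v] is its restriction to [F] and [u]
   fixes [F] pointwise. *)
have <- : [set p.1 * p.2 | p in setX (young x l) [set s | perm_on F s]] =
          young x (a :: l).
  apply/setP=> s; apply/imsetP/idP => [[[u v] /=]|].
    rewrite !inE /= => /andP[/forallP uP vP] ->.
    apply/forallP => j; rewrite permM inE.
    have /andP[/eqP xu lu] := uP j.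
    have xv : x (v (u j)) = x (u j).
      have [/[dup]|/(out_perm vP) -> //] := boolP (u j \in F).
      by rewrite -{1}(perm_closed _ vP) !inE => /eqP -> /eqP ->.
    rewrite xv xu eqxx /=; case/orP: lu => [->|/eqP uj]; first by rewrite orbT.
    rewrite uj; have [] := boolP (j \in F); first by rewrite inE => ->.
    by move/(out_perm vP) ->; rewrite eqxx orbT.
  rewrite inE => /forallP sP.
  have sN : s \in 'N(F | 'P).
    apply/astabsP => j /=; rewrite !inE apermE.
    by have /andP[/eqP -> _] := sP j.
  have rF := restr_perm_on F s.
  exists (s * (restr_perm F s)^-1, restr_perm F s); last by rewrite /= mulgKV.
  rewrite !inE /= rF andbT; apply/forallP => j; rewrite permM.
  have /andP[/eqP xs] := sP j.
  have [jF|jF] := boolP (j \in F).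
    have -> : (restr_perm F s)^-1 (s j) = j.
      by rewrite -(restr_permE sN jF) permK.
    by rewrite !eqxx orbT.
  have -> : (restr_perm F s)^-1 (s j) = s j.
    rewrite (out_perm (S := F)) ?perm_onV //.
    by move: jF; rewrite !inE xs.
  by rewrite xs eqxx inE /=; move: jF; rewrite inE => /negPf ->.
rewrite card_in_imset // => -[u v] [u' v']; rewrite !inE /=.
move=> /andP[/forallP uP vP] /andP[/forallP uP' vP'] E.
(* Uniqueness of the factorization: since [a] is not in [l], both [u] and [u'] fix [F] pointwise, so
   the product determines [v] on [F]. *)
have Ev : v = v'.
  apply/permP => j; have [jF|jF] := boolP (j \in F); last first.
    by rewrite (out_perm vP jF) (out_perm vP' jF).
  have := congr1 (fun s : 'S_N => s j) E; rewrite !permM.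
  have xja : x j = a by move: jF; rewrite inE => /eqP.
  have /andP[_] := uP j; rewrite xja (negPf al) => /eqP ->.
  by have /andP[_] := uP' j; rewrite xja (negPf al) => /eqP ->.
by move: E; rewrite Ev => /mulIg ->.
Qed.

Lemma nstabE x : nstab x = (\prod_a (nocc x a)`!)%N.
Proof.
rewrite -[RHS]big_enum /= -card_young ?enum_uniq //; apply: eq_card => s.
rewrite !inE; apply/eqP/forallP => [xs j|xs].
  by rewrite mem_enum orTb andbT -{1}xs ffunE permK.
apply/ffunP => j; rewrite ffunE.
by have /andP[/eqP + _] := xs (s^-1 j); rewrite permKV => ->.
Qed.

Lemma nstab_gt0 x : (0 < nstab x)%N.
Proof. by rewrite card_gt0; apply/set0Pn; exists 1; rewrite inE permute1. Qed.

Lemma nocc_permute x s a : nocc (permute s x) a = nocc x a.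
Proof.
rewrite /nocc -(card_imset [pred j | x j == a] (@perm_inj _ s)).
apply: eq_card => j; rewrite !inE ffunE; apply/idP/imsetP => [xj|[i xi ->]].
  by exists (s^-1 j); rewrite ?permKV.
by rewrite permK.
Qed.

Lemma sum_nocc x : (\sum_a nocc x a)%N = N.
Proof.
rewrite -[RHS]card_ord -sum1_card (partition_big x predT) //=.
by apply: eq_bigr => a _; rewrite /nocc -sum1_card; apply: eq_bigl.
Qed.

Lemma astab1_permute x : 'C[x | permute_action] = [set s | permute s x == x].
Proof. by apply/setP => s; rewrite !inE sub1set inE. Qed.

(** A nonempty fiber of the orbit map is a coset of the stabilizer. *)
Lemma card_permute_fiber x y :
  #|[set s : 'S_N | permute s x == y]| =
  if [exists s : 'S_N, permute s x == y] then nstab x else 0%N.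
Proof.
case: existsP => [[s0 /eqP <-]|ns]; last first.
  by apply: eq_card0 => s; rewrite inE; apply/negP => xs; apply: ns; exists s.
have := amove_act permute_action (G := [set: 'S_N]) x (subsetT _) (in_setT s0).
move/(congr1 (fun B : {set _} => #|B|)); rewrite card_rcoset setTI astab1_permute.
rewrite /nstab => <-.
by apply: eq_card => s; rewrite !inE.
Qed.

Lemma card_permute_orbit x :
  (#|[set permute s x | s : 'S_N]| * nstab x)%N = N`!.
Proof.
rewrite -card_Sn.
have := card_orbit_stab permute_action [set: 'S_N]%G x.
rewrite setTI astab1_permute cardsT => <-; congr (_ * _)%N.
apply: eq_card => y.
by apply/imsetP/imsetP => -[s _ ->]; exists s; rewrite ?inE.
Qed.

End PermuteAction.

(** * Fibers and orbits of joint rearrangements *)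

Section PermJoint.
Variables (d n : nat) (Xi : forall N : nat, 'I_n -> {ffun 'I_N -> 'I_d}).
Implicit Type N : nat.

(** This is the order of the stabilizer of [Xi N] in the product group; divided by [N!^n] it is the
    probability of each reachable joint sequence. *)
Definition stab_prod N : nat := \prod_i nstab (Xi N i).

Lemma stab_prod_gt0 N : (0 < stab_prod N)%N.
Proof. by apply: prodn_gt0 => i; apply: nstab_gt0. Qed.

Lemma perm_joint_eqE N (sig : {ffun 'I_n -> 'S_N}) (y : {ffun 'I_N -> Xn d n}) :
  (perm_joint Xi sig == y) =
  [forall i, permute (sig i) (Xi N i) == [ffun j => y j i]].
Proof.
apply/eqP/forallP => [<- i|E].
  by apply/eqP/ffunP => j; rewrite !ffunE.
apply/ffunP => j; apply/ffunP => i; rewrite !ffunE.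
by have /eqP/ffunP/(_ j) := E i; rewrite !ffunE.
Qed.

(** The coordinates decouple: the fiber is a product of [n] fibers, each a coset of a stabilizer or
    empty. *)
Lemma card_perm_joint_fiber N (y : {ffun 'I_N -> Xn d n}) :
  #|[pred sig | perm_joint Xi sig == y]| =
  if [exists sig, perm_joint Xi sig == y] then stab_prod N else 0%N.
Proof.
pose S i := [set s | permute s (Xi N i) == [ffun j => y j i]].
have -> : #|[pred sig | perm_joint Xi sig == y]| = (\prod_i #|S i|)%N.
  transitivity #|(family (fun i => mem (S i)) : pred {ffun 'I_n -> 'S_N})|.
    apply: eq_card => sig.
    rewrite !inE perm_joint_eqE; apply/forallP/familyP => E i.
      by rewrite inE.
    by have := E i; rewrite inE.
  by rewrite card_family foldrE big_image.
case: existsP => [[sig]|ns].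
  rewrite perm_joint_eqE => /forallP E; apply: eq_bigr => i _.
  rewrite card_permute_fiber ifT //; apply/existsP; exists (sig i); exact: E.
have [|] := boolP [forall i, S i != set0]; last first.
  move=> /forallPn[i /negPn/eqP Si].
  by rewrite (bigD1 i) //= Si cards0.
move=> /forallP S0; case: ns.
have e i : exists s, s \in S i by apply/set0Pn.
exists [ffun i => xchoose (e i)]; rewrite perm_joint_eqE; apply/forallP => i.
by rewrite ffunE; have := xchooseP (e i); rewrite inE.
Qed.

Lemma permute_perm_joint N (sig : {ffun 'I_n -> 'S_N}) (s : 'S_N) :
  permute s (perm_joint Xi sig) = perm_joint Xi [ffun i => (sig i * s)%g].
Proof.
apply/ffunP => j; apply/ffunP => i.
by rewrite !ffunE invMg permM.
Qed.

(** The diagonal action of [S_N] preserves the reachable joint sequences. The orbit has [N! / nstab]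
    points, all satisfying [P], and each has exactly [stab_prod] preimages; the inequality is
    cleared of denominators. *)
Lemma card_perm_joint_orbit N (sig : {ffun 'I_n -> 'S_N})
    (P : pred {ffun 'I_N -> Xn d n}) :
  (forall s, P (permute s (perm_joint Xi sig))) ->
  (stab_prod N * N`! <=
   #|[pred sg | P (perm_joint Xi sg)]| * nstab (perm_joint Xi sig))%N.
Proof.
move=> PP; rewrite -(card_permute_orbit (perm_joint Xi sig)) mulnA leq_mul2r.
apply/orP; right.
set O := [set _ | _ in _].
rewrite -[X in (_ <= X)%N]sum1_card (partition_big (@perm_joint d n Xi N) predT) //=.
rewrite mulnC -sum_nat_const [X in (_ <= X)%N](bigID (mem O)) /=.
apply: leq_trans (leq_addr _ _); apply: leq_sum => y /imsetP[s _ ->].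
rewrite permute_perm_joint; set y' := perm_joint _ _.
have := card_perm_joint_fiber y'; rewrite ifT; last first.
  by apply/existsP; eexists; apply/eqP.
move=> <-; rewrite -sum1_card.
rewrite [X in (_ <= X)%N](eq_bigl (fun sg => perm_joint Xi sg == y')) //.
move=> sg /=; rewrite inE andb_idl // => /eqP ->.
by rewrite /y' -permute_perm_joint.
Qed.

End PermJoint.

Lemma perm_eq_permute (N : nat) (A : finType) (x : {ffun 'I_N -> A}) (s : seq A) :
  (perm_eq s [seq x j | j <- enum 'I_N]) ->
  exists p : 'S_N, forall j : 'I_N, forall a, permute p x j = nth a s j.
Proof.
move=> sx; pose t := [tuple x j | j < N].
have /tuple_permP[p Ep] : perm_eq s t by [].
exists p^-1%g => j a; rewrite ffunE invgK Ep.
by rewrite -tnth_nth !tnth_mktuple.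
Qed.

Lemma count_codom (N : nat) (A : finType) (x : {ffun 'I_N -> A}) a :
  count_mem a [seq x j | j <- enum 'I_N] = nocc x a.
Proof.
rewrite count_map -sum1_count big_enum_cond /nocc -sum1_card.
by apply: eq_bigl => j; rewrite !inE.
Qed.

(* Lay down [k a] copies of each [a], then complete each coordinate arbitrarily
   to a rearrangement of [Xi N i]. *)
Lemma perm_joint_dominating (d n : nat)
    (Xi : forall N : nat, 'I_n -> {ffun 'I_N -> 'I_d}) (N : nat)
    (k : Xn d n -> nat) :
  (\sum_a k a <= N)%N ->
  (forall i t, \sum_(a : Xn d n | a i == t) k a <= nocc (Xi N i) t)%N ->
  exists sig : {ffun 'I_n -> 'S_N},
    forall a, (k a <= nocc (perm_joint Xi sig) a)%N.
Proof.
move=> kN kle.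
pose L := flatten [seq nseq (k a) a | a <- index_enum (Xn d n)].
have cL (P : pred (Xn d n)) : count P L = (\sum_(a | P a) k a)%N.
  rewrite count_flatten sumnE !big_map [RHS]big_mkcond /=.
  by apply: eq_bigr => a _; rewrite count_nseq; case: (P a); rewrite (mul0n, mul1n).
have sL : (size L <= N)%N.
  by rewrite -count_predT cL; apply: kN.
have H i : exists s : 'S_N, forall (j : 'I_N), (j < size L)%N ->
     forall a, permute s (Xi N i) j = nth a L j i.
  pose Li := [seq a i | a : Xn d n <- L].
  pose xi := [seq Xi N i j | j <- enum 'I_N].
  (* The [i]-th letters of [L] form a sub-multiset of those of [Xi N i]; the leftover letters [R]
     fill the remaining positions. *)
  have /count_subseqP[s sxi Ls] : forall t, (count_mem t Li <= count_mem t xi)%N.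
    by move=> t; rewrite count_codom count_map cL; apply: kle.
  have [R sR] := perm_to_subseq sxi.
  have LR : perm_eq (Li ++ R) xi.
    by rewrite perm_sym (perm_trans sR) // perm_cat2r perm_sym.
  have [p pP] := perm_eq_permute LR.
  exists p => j jL a; rewrite (pP j (a i)) nth_cat size_map jL.
  by rewrite (nth_map a).
(* The property is restated as a boolean so that [xchoose] can select one permutation per
   coordinate. *)
have {}H i : exists s : 'S_N, [forall j : 'I_N, (j < size L)%N ==>
     [forall a, permute s (Xi N i) j == nth a L j i]].
  have [s sP] := H i; exists s; apply/forallP => j; apply/implyP => jL.
  by apply/forallP => a; apply/eqP; apply: sP.
exists [ffun i => xchoose (H i)] => a.
(* The copies of [a] in [L] sit at distinct positions, each of which is an occurrence of [a] in the
   joint sequence. *)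
have -> : k a = size [seq j <- iota 0 (size L) | nth a L j == a].
  rewrite -(big_pred1_eq addn a k) -(cL (pred1 a)) -{1}(mkseq_nth a L).
  by rewrite count_map size_filter.
rewrite /nocc cardE -(size_map val).
apply: uniq_leq_size; first by rewrite filter_uniq // iota_uniq.
move=> j; rewrite mem_filter mem_iota add0n /= => /andP[/eqP La jL].
have jN := leq_trans jL sL.
apply/mapP; exists (Ordinal jN) => //.
rewrite mem_enum inE; apply/eqP/ffunP => i; rewrite !ffunE.
have /forallP/(_ (Ordinal jN))/implyP/(_ jL)/forallP/(_ a)/eqP := xchooseP (H i).
by rewrite !ffunE /= La.
Qed.

(** * Finite real sums and Stirling bounds *)

Local Open Scope R_scope.

Lemma RplusA : associative Rplus. Proof. by move=> x y z; ring. Qed.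
Lemma RplusC : commutative Rplus. Proof. exact: Rplus_comm. Qed.
Lemma Rplus0x : left_id 0 Rplus. Proof. exact: Rplus_0_l. Qed.
HB.instance Definition _ := Monoid.isComLaw.Build R 0 Rplus RplusA RplusC Rplus0x.

Lemma RmultA : associative Rmult. Proof. by move=> x y z; ring. Qed.
Lemma RmultC : commutative Rmult. Proof. exact: Rmult_comm. Qed.
Lemma Rmult1x : left_id 1 Rmult. Proof. exact: Rmult_1_l. Qed.
HB.instance Definition _ := Monoid.isComLaw.Build R 1 Rmult RmultA RmultC Rmult1x.

Lemma Rmult0x : left_zero 0 Rmult. Proof. exact: Rmult_0_l. Qed.
Lemma Rmultx0 : right_zero 0 Rmult. Proof. exact: Rmult_0_r. Qed.
HB.instance Definition _ := Monoid.isMulLaw.Build R 0 Rmult Rmult0x Rmultx0.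

Lemma RmultDl : left_distributive Rmult Rplus. Proof. by move=> x y z; ring. Qed.
Lemma RmultDr : right_distributive Rmult Rplus. Proof. by move=> x y z; ring. Qed.
HB.instance Definition _ := Monoid.isAddLaw.Build R Rmult Rplus RmultDl RmultDr.

Section RealSums.
Variable T : finType.
Implicit Types (P : pred T) (F G : T -> R).

Lemma Rsum_le_cond P F G : (forall x, P x -> F x <= G x) ->
  \big[Rplus/0]_(x | P x) F x <= \big[Rplus/0]_(x | P x) G x.
Proof.
move=> FG; elim/big_ind2: _ => // [|a b a' b' *]; first exact: Rle_refl.
exact: Rplus_le_compat.
Qed.

Lemma Rsum_le F G : (forall x, F x <= G x) -> Rsum F <= Rsum G.
Proof. by move=> FG; apply: Rsum_le_cond. Qed.

Lemma Rsum_ext F G : (forall x, F x = G x) -> Rsum F = Rsum G.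
Proof. by move=> FG; apply: eq_bigr. Qed.

Lemma RsumD F G : Rsum (fun x => F x + G x) = Rsum F + Rsum G.
Proof. exact: big_split. Qed.

Lemma RsumZ c F : Rsum (fun x => c * F x) = c * Rsum F.
Proof. by rewrite /Rsum big_distrr. Qed.

Lemma RsumN F : Rsum (fun x => - F x) = - Rsum F.
Proof.
rewrite -[RHS]Rmult_1_l -Ropp_mult_distr_r Ropp_mult_distr_l -RsumZ.
by apply: Rsum_ext => x; ring.
Qed.

Lemma RsumB F G : Rsum (fun x => F x - G x) = Rsum F - Rsum G.
Proof. by rewrite /Rminus -RsumN -RsumD. Qed.

Lemma Rsum_const c : Rsum (fun _ : T => c) = INR #|T| * c.
Proof.
rewrite /Rsum big_const; elim: #|T| => [|k IH]; first by rewrite Rmult_0_l.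
by rewrite S_INR /= IH; ring.
Qed.

Lemma Rsum_ge0_cond P F : (forall x, 0 <= F x) -> 0 <= \big[Rplus/0]_(x | P x) F x.
Proof.
move=> F0; elim/big_rec: _ => [|x y _ y0]; first exact: Rle_refl.
by have := F0 x; lra.
Qed.

Lemma Rsum_ge0 F : (forall x, 0 <= F x) -> 0 <= Rsum F.
Proof. exact: Rsum_ge0_cond. Qed.

Lemma Rsum_ge_term F x0 : (forall x, 0 <= F x) -> F x0 <= Rsum F.
Proof.
move=> F0; rewrite /Rsum (bigD1 x0) //=.
by have := Rsum_ge0_cond (fun i => i != x0) F0; lra.
Qed.

Lemma Rsum_Rabs F : Rabs (Rsum F) <= Rsum (fun x => Rabs (F x)).
Proof.
rewrite /Rsum; elim/big_ind2: _ => // [|a b a' b' Ha Hb|x _].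
- by rewrite Rabs_R0; lra.
- by apply: Rle_trans (Rabs_triang _ _) _; lra.
- exact: Rle_refl.
Qed.

Lemma INR_sum P (k : T -> nat) :
  INR (\sum_(x | P x) k x)%N = \big[Rplus/0]_(x | P x) INR (k x).
Proof. by apply: (big_morph INR) => // a b; exact: plus_INR. Qed.

Lemma ln_prod F : (forall x, 0 < F x) ->
  ln (\big[Rmult/1]_x F x) = Rsum (fun x => ln (F x)).
Proof.
move=> F0; rewrite /Rsum.
suff [] : 0 < \big[Rmult/1]_x F x /\
    ln (\big[Rmult/1]_x F x) = \big[Rplus/0]_x ln (F x) by [].
elim/big_rec2: _ => [|x a b _ [a0 ab]]; first by split; [lra | exact: ln_1].
by split; [exact: Rmult_lt_0_compat | rewrite ln_mult // ab].
Qed.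

Lemma exp_sum F : exp (Rsum F) = \big[Rmult/1]_x exp (F x).
Proof. by apply: (big_morph exp) => [a b|]; [exact: exp_plus | exact: exp_0]. Qed.

Lemma INR_ln_prod (k : T -> nat) : (forall x, (0 < k x)%N) ->
  ln (INR (\prod_x k x)%N) = Rsum (fun x => ln (INR (k x))).
Proof.
move=> k0; rewrite -ln_prod => [|x]; last by apply: lt_0_INR; apply/ltP.
congr ln; apply: (big_morph INR) => // a b; exact: mult_INR.
Qed.

End RealSums.

Lemma Rabs_le_inv x y : Rabs x <= y -> - y <= x <= y.
Proof. by move=> xy; have := Rle_abs x; have := Rle_abs (- x); rewrite Rabs_Ropp; lra. Qed.

Lemma ln_div x y : 0 < x -> 0 < y -> ln (x / y) = ln x - ln y.
Proof.
move=> x0 y0; rewrite /Rdiv ln_mult ?ln_Rinv //; exact: Rinv_0_lt_compat.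
Qed.

Lemma ln_le_sub1 x : 0 < x -> ln x <= x - 1.
Proof.
move=> x0; have := exp_ineq1_le (ln x); rewrite exp_ln //; lra.
Qed.

Lemma ln_le x y : 0 < x -> x <= y -> ln x <= ln y.
Proof.
by move=> x0 [/(ln_increasing _ _ x0)|->]; [exact: Rlt_le | exact: Rle_refl].
Qed.

(** The induction rests on [x (ln (x+1) - ln x) <= 1 <= (x+1) (ln (x+1) - ln x)]. The shift
    [INR k + 1] inside the logarithm keeps the bound valid at [k = 0]. *)
Lemma ln_fact_bounds (k : nat) :
  Rabs (ln (INR k`!) - (INR k * ln (INR k) - INR k)) <= ln (INR k + 1) + 1.
Proof.
case: k => [|k]; first by rewrite fact0 /= Rplus_0_l ln_1 Rabs_right; lra.
suff H : INR k.+1 * ln (INR k.+1) - INR k.+1 <= ln (INR (k.+1)`!) <=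
         INR k.+1 * ln (INR k.+1) - INR k.+1 + ln (INR k.+1) + 1.
  have k0 : 0 < INR k.+1 by apply: lt_0_INR; apply/ltP.
  have l : ln (INR k.+1) <= ln (INR k.+1 + 1) by apply: ln_le; lra.
  have l0 : 0 <= ln (INR k.+1 + 1) by rewrite -ln_1; apply: ln_le; lra.
  by apply: Rabs_le; lra.
elim: k => [|k IH]; first by rewrite /= ln_1; lra.
have k0 : 0 < INR k.+1 by apply: lt_0_INR; apply/ltP.
have f0 : 0 < INR (k.+1)`! by apply: lt_0_INR; apply/ltP; exact: fact_gt0.
rewrite factS mult_INR ln_mult //; last by rewrite S_INR; lra.
rewrite (S_INR k.+1); set x := INR k.+1 in k0 IH *.
have x1 : 0 < x + 1 by lra.
have A : ln (x + 1) - ln x <= / x.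
  have := ln_le_sub1 (x := (x + 1) / x); rewrite ln_div //.
  have -> : (x + 1) / x - 1 = / x by field; lra.
  by apply; apply: Rdiv_lt_0_compat.
have B : ln x - ln (x + 1) <= - / (x + 1).
  have := ln_le_sub1 (x := x / (x + 1)); rewrite ln_div //.
  have -> : x / (x + 1) - 1 = - / (x + 1) by field; lra.
  by apply; apply: Rdiv_lt_0_compat.
have A' : x * (ln (x + 1) - ln x) <= 1.
  by rewrite -[X in _ <= X](Rinv_r x); [apply: Rmult_le_compat_l; lra | lra].
have B' : (x + 1) * (ln x - ln (x + 1)) <= -1.
  have -> : -1 = (x + 1) * - / (x + 1) by field; lra.
  by apply: Rmult_le_compat_l; lra.
lra.
Qed.

Lemma INR_gt0 (k : nat) : (0 < k)%N -> 0 < INR k.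
Proof. by move=> /ltP; exact: lt_0_INR. Qed.

Lemma INR_leq (m k : nat) : (m <= k)%N -> INR m <= INR k.
Proof. by move=> /leP; exact: le_INR. Qed.

(** One factorial error for [N!] and one for each of the [a] letters, normalized by [N]. *)
Definition stirling_err (a N : nat) : R :=
  (INR a + 1) * ((ln (INR N + 1) + 1) / INR N).

(** The quotient [N! / nstab x] is a multinomial coefficient. In Stirling's main terms the linear
    parts cancel because the counts sum to [N], and what is left is exactly [N] times the entropy of
    the type; only the errors [th] remain. *)
Lemma ln_stab_entropy (A : finType) (N : nat) (x : {ffun 'I_N -> A}) : (0 < N)%N ->
  Rabs (/ INR N * (ln (INR N`!) - ln (INR (nstab x))) - entropy (seq_type x))
  <= stirling_err #|A| N.
Proof.
move=> N0; have rN := INR_gt0 N0.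
pose th (k : nat) := ln (INR k`!) - (INR k * ln (INR k) - INR k).
have thP k : (k <= N)%N -> Rabs (th k) <= ln (INR N + 1) + 1.
  move=> kN; apply: Rle_trans (ln_fact_bounds k) _.
  have k0 := pos_INR k; have := INR_leq kN => kN'.
  by have := ln_le (x := INR k + 1) (y := INR N + 1); lra.
have kle a : (nocc x a <= N)%N.
  by rewrite -[X in (_ <= X)%N](sum_nocc x) (bigD1 a) //= leq_addr.
have sk : Rsum (fun a => INR (nocc x a)) = INR N by rewrite /Rsum -INR_sum sum_nocc.
have E : / INR N * (ln (INR N`!) - ln (INR (nstab x))) - entropy (seq_type x) =
   / INR N * (th N - Rsum (fun a => th (nocc x a))).
  rewrite nstabE INR_ln_prod => [|a]; last exact: fact_gt0.
  have -> : entropy (seq_type x) =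
     / INR N * (INR N * ln (INR N) - Rsum (fun a => INR (nocc x a) * ln (INR (nocc x a)))).
    have -> : INR N * ln (INR N) = Rsum (fun a => ln (INR N) * INR (nocc x a)).
      by rewrite RsumZ sk Rmult_comm.
    rewrite -RsumB -RsumZ /entropy -RsumN.
    apply: Rsum_ext => a; rewrite /seq_type -/(nocc x a).
    case: (posnP (nocc x a)) => [->|k0]; first by rewrite /=; field; lra.
    by rewrite ln_div //; [field; lra | exact: INR_gt0].
  rewrite RsumB RsumB sk /th; field; lra.
rewrite E Rabs_mult Rabs_inv Rabs_right; last lra.
rewrite /stirling_err.
have -> : (INR #|A| + 1) * ((ln (INR N + 1) + 1) / INR N) =
  / INR N * ((ln (INR N + 1) + 1) + INR #|A| * (ln (INR N + 1) + 1)) by field; lra.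
apply: Rmult_le_compat_l; first by apply/Rlt_le/Rinv_0_lt_compat.
rewrite /Rminus; apply: Rle_trans (Rabs_triang _ _) _; rewrite Rabs_Ropp.
apply: Rplus_le_compat; first exact: thP.
apply: Rle_trans (Rsum_Rabs _) _; rewrite -Rsum_const.
by apply: Rsum_le => a; apply: thP.
Qed.

(** * Limits, entropy continuity and approximation by types *)

(** Makes a choice uniform over a finite type. It serves both for thresholds, with [maxn], and for
    radii, with the minimum. *)
Lemma finite_meet (T : finType) (I : Type) (Q : T -> I -> Prop) (meet : I -> I -> I)
    (i0 : I) :
  (forall a i j, Q a i -> Q a (meet i j)) ->
  (forall a i j, Q a j -> Q a (meet i j)) ->
  (forall a, exists i, Q a i) -> exists i, forall a, Q a i.
Proof.
move=> Ql Qr ex.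
suff [i iP] : exists i, forall a, a \in enum T -> Q a i.
  by exists i => a; apply: iP; rewrite mem_enum.
elim: (enum T) => [|a l [i iP]]; first by exists i0.
have [j jP] := ex a; exists (meet j i) => b; rewrite inE => /orP[/eqP ->|/iP].
  exact: Ql.
exact: Qr.
Qed.

Definition evt (P : nat -> Prop) := exists M, forall N, (M <= N)%N -> P N.

Lemma evt_mono (P Q : nat -> Prop) : (forall N, P N -> Q N) -> evt P -> evt Q.
Proof. by move=> PQ [M PM]; exists M => N /PM/PQ. Qed.

Lemma evt_and (P Q : nat -> Prop) : evt P -> evt Q -> evt (fun N => P N /\ Q N).
Proof.
move=> [M PM] [K QK]; exists (maxn M K) => N; rewrite geq_max => /andP[/PM ? /QK ?].
by split.
Qed.

Lemma evt_forall (T : finType) (P : T -> nat -> Prop) :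
  (forall a, evt (P a)) -> evt (fun N => forall a, P a N).
Proof.
move=> eP.
have [||M MP] := finite_meet (Q := fun a M => forall N, (M <= N)%N -> P a N)
  (meet := maxn) 0%N _ _ eP.
- by move=> a i j iP N; rewrite geq_max => /andP[/iP].
- by move=> a i j jP N; rewrite geq_max => /andP[_ /jP].
by exists M => N MN a; apply: MP.
Qed.

Lemma evt_gt0 : evt (fun N => (0 < N)%N).
Proof. by exists 1%N. Qed.

Lemma evt_INR_gt c : evt (fun N => c < INR N).
Proof.
have [M cM] := INR_unbounded c; exists M => N MN.
by have := INR_leq MN; lra.
Qed.

Lemma Un_cv_evt (u : nat -> R) l eps :
  Un_cv u l -> 0 < eps -> evt (fun N => Rabs (u N - l) < eps).
Proof. by move=> ul /ul[M MP]; exists M => N /leP MN; apply: MP. Qed.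

Lemma ln_le_2sqrt x : 0 < x -> ln x <= 2 * sqrt x.
Proof.
move=> x0; have s0 := sqrt_lt_R0 _ x0.
rewrite -{1}(sqrt_sqrt x); last lra.
by rewrite ln_mult //; have := ln_le_sub1 s0; lra.
Qed.

Lemma stirling_err_cv0 a eps : 0 < eps -> evt (fun N => stirling_err a N < eps).
Proof.
(* For [N >= 1] the error is at most [4 (a+1) / sqrt N], which drops below [eps] once
   [sqrt N > c]. *)
move=> e0; pose c := 4 * (INR a + 1) / eps.
have a0 := pos_INR a.
have c0 : 0 < c by apply: Rdiv_lt_0_compat; lra.
apply: evt_mono (evt_and evt_gt0 (evt_INR_gt (c * c))) => N [N0 cN].
have rN := INR_gt0 N0; have N1 : 1 <= INR N by exact: (INR_leq N0).
set s := sqrt (INR N); have s0 : 0 < s by exact: sqrt_lt_R0.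
have ss : INR N = s * s by rewrite sqrt_sqrt; lra.
have s1 : 1 <= s by rewrite -sqrt_1; apply: sqrt_le_1_alt.
have cs : c < s by apply: Rnot_le_lt => sc; nra.
have l : ln (INR N + 1) <= 1 + 2 * s.
  apply: (Rle_trans _ (ln (2 * INR N))); first by apply: ln_le; lra.
  rewrite ln_mult; [|lra|lra].
  have := ln_le_sub1 (x := 2); have := ln_le_2sqrt rN; rewrite -/s; lra.
apply: (Rle_lt_trans _ ((INR a + 1) * (4 / s))).
  apply: Rmult_le_compat_l; first lra.
  rewrite ss; apply: (Rmult_le_reg_r (s * s)); first nra.
  rewrite /Rdiv Rmult_assoc Rinv_l; last nra.
  have -> : 4 * / s * (s * s) = 4 * s by field; lra.
  rewrite -ss; lra.
apply: (Rmult_lt_reg_r (s / eps)); first exact: Rdiv_lt_0_compat.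
have -> : (INR a + 1) * (4 / s) * (s / eps) = c by rewrite /c; field; lra.
by have -> : eps * (s / eps) = s by field; lra.
Qed.

Lemma xlnx_continuous p eps : 0 <= p -> 0 < eps -> exists delta : posreal,
  forall q, 0 <= q -> Rabs (q - p) < delta -> Rabs (q * ln q - p * ln p) < eps.
Proof.
move=> [p0|<-] e0.
  have cont : continuity_pt (fun x => x * ln x) p.
    apply: (continuity_pt_mult (fun x => x) ln).
      exact: derivable_continuous_pt (derivable_pt_id p).
    by apply: derivable_continuous_pt; exists (/ p); exact: derivable_pt_lim_ln.
  have [al [al0 alP]] := cont eps e0.
  exists (mkposreal al al0) => q q0 /= qp.
  have [<-|pq] := Req_dec p q; first by rewrite Rminus_diag Rabs_R0.
  exact: alP.
(* At [p = 0] the estimate is [q |ln q| <= 2 sqrt q]: the bound 1 makes [ln q] negative, and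
   [eps^2 / 4] makes [2 sqrt q < eps]. *)
have d0 : 0 < Rmin 1 (eps * eps / 4) by apply: Rmin_pos; nra.
exists (mkposreal _ d0) => q /= q0; rewrite Rminus_0_r Rabs_right; last lra.
move=> qd; rewrite Rmult_0_l Rminus_0_r.
have q1 := Rlt_le_trans _ _ _ qd (Rmin_l _ _).
have q2 := Rlt_le_trans _ _ _ qd (Rmin_r _ _).
case: q0 => [q0|<-]; last by rewrite Rmult_0_l Rabs_R0.
set s := sqrt q; have s0 : 0 < s by exact: sqrt_lt_R0.
have ss : q = s * s by rewrite sqrt_sqrt; lra.
have se : 2 * s < eps by apply: Rnot_le_lt => sc; nra.
have lq : ln q < 0 by rewrite -ln_1; apply: ln_increasing.
rewrite Rabs_left; last nra.
have l : - ln q <= 2 * / s.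
  rewrite {1}ss ln_mult //.
  have := ln_le_sub1 (Rinv_0_lt_compat _ s0); rewrite ln_Rinv //; lra.
apply: Rle_lt_trans se.
have -> : 2 * s = q * (2 * / s) by rewrite ss; field; lra.
nra.
Qed.

Lemma entropy_continuous (T : finType) (p : T -> R) eps :
  (forall a, 0 <= p a) -> 0 < eps -> exists delta : posreal,
  forall q : T -> R, (forall a, 0 <= q a) -> (forall a, Rabs (q a - p a) < delta) ->
  Rabs (entropy q - entropy p) < eps.
Proof.
move=> p0 e0; pose e1 := eps / (INR #|T| + 1).
have K0 := pos_INR #|T|.
have e10 : 0 < e1 by apply: Rdiv_lt_0_compat; lra.
pose meet (x y : posreal) := mkposreal (Rmin x y) (Rmin_stable_in_posreal x y).
have [||delta dP] := finite_meet (meet := meet) (mkposreal 1 Rlt_0_1) _ _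
  (fun a => xlnx_continuous (p0 a) e10).
- move=> a i j iP q q0 qp; apply: iP => //; apply: Rlt_le_trans qp _; exact: Rmin_l.
- move=> a i j jP q q0 qp; apply: jP => //; apply: Rlt_le_trans qp _; exact: Rmin_r.
exists delta => q q0 qp; rewrite /entropy.
set A := Rsum _; set B := Rsum _.
have -> : - A - - B = - (A - B) by ring.
rewrite Rabs_Ropp /A /B -RsumB; apply: Rle_lt_trans (Rsum_Rabs _) _.
apply: (Rle_lt_trans _ (Rsum (fun _ : T => e1))).
  by apply: Rsum_le => a; apply/Rlt_le/dP.
rewrite Rsum_const; have -> : eps = INR #|T| * e1 + e1 by rewrite /e1; field; lra.
lra.
Qed.

Lemma limsup_exists (u : nat -> ER) b B :
  evt (fun N => ER_lt_R (u N) B) ->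
  (forall M, exists N, (M <= N)%N /\ R_lt_ER b (u N)) ->
  exists L, limsup_is u L.
Proof.
move=> [M0 uB] ub.
(* The limsup is the supremum of the levels exceeded infinitely often; [b] is such a level and [B]
   bounds them all. *)
pose E c := forall M, exists N, (M <= N)%N /\ R_lt_ER c (u N).
have Eb : bound E.
  exists B => c /(_ M0)[N [/uB]]; case: (u N) => //= r; lra.
have [L [Lub Llub]] := completeness E Eb (ex_intro _ b ub).
exists L => eps e0; split.
  have nE : ~ E (L + eps / 2) by move/Lub; lra.
  have [M HM] := not_all_ex_not _ _ nE; exists M => N MN.
  have := not_ex_all_not _ _ HM N; case: (u N) => //= r nr.
  by apply: Rnot_le_lt => h; apply: nr; split=> //; lra.
apply: NNPP => nH; suff : L <= L - eps by lra.
apply: Llub => c Ec; apply: Rnot_lt_le => cL; apply: nH => M.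
have [N [MN uN]] := Ec M; exists N; split=> //; move: uN.
by case: (u N) => //= r; lra.
Qed.

Lemma limsup_le (u : nat -> ER) L B :
  limsup_is u L -> evt (fun N => ER_lt_R (u N) B) -> L <= B.
Proof.
move=> uL [M uB]; apply: Rnot_lt_le => BL.
have [|_ /(_ M)[N [/uB]]] := uL (L - B); first lra.
case: (u N) => //= r; lra.
Qed.

Lemma limsup_ge (u : nat -> ER) L b :
  limsup_is u L -> evt (fun N => R_lt_ER b (u N)) -> b <= L.
Proof.
move=> uL [M ub]; apply: Rnot_lt_le => Lb.
have [|[K uK] _] := uL (b - L); first lra.
have := ub _ (leq_maxl M K); have := uK _ (leq_maxr M K).
case: (u _) => //= r; lra.
Qed.

Lemma evt_often (P : nat -> Prop) :
  evt P -> forall M, exists N, (M <= N)%N /\ P N.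
Proof.
by move=> [K PK] M; exists (maxn M K); split; [exact: leq_maxl | apply/PK/leq_maxr].
Qed.

Definition nfloor (x : R) : nat := Z.to_nat (Int_part x).

Lemma nfloorP x : 0 <= x -> INR (nfloor x) <= x < INR (nfloor x) + 1.
Proof.
move=> x0; have [h1 h2] := base_Int_part x.
have z0 : (0 <= Int_part x)%Z.
  by apply/Z.lt_succ_r; apply: lt_IZR; rewrite succ_IZR; lra.
by rewrite /nfloor INR_IZR_INZ Z2Nat.id //; lra.
Qed.

Section SeqType.
Variables (A : finType) (N : nat).
Implicit Type x : {ffun 'I_N -> A}.

Lemma seq_type_ge0 x a : (0 < N)%N -> 0 <= seq_type x a.
Proof.
move=> N0; apply: Rmult_le_pos; first exact: pos_INR.
by apply/Rlt_le/Rinv_0_lt_compat/INR_gt0.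
Qed.

Lemma seq_type_sum x : (0 < N)%N -> Rsum (seq_type x) = 1.
Proof.
move=> N0; have rN := INR_gt0 N0.
have -> : Rsum (seq_type x) = / INR N * Rsum (fun a => INR (nocc x a)).
  by rewrite -RsumZ; apply: Rsum_ext => a; rewrite /seq_type -/(nocc x a) Rmult_comm.
by rewrite /Rsum -INR_sum sum_nocc; field; lra.
Qed.

Lemma in_DeltaP (mu : A -> R) delta x :
  reflect (forall a, Rabs (seq_type x a - mu a) < delta) (in_Delta mu delta x).
Proof.
apply: (iffP forallP) => H a; have := H a; rewrite /Rltb; case: Rlt_dec => //.
Qed.

Lemma kappa_seq_type (h : A -> R) x :
  / INR N * Rsum (fun j => h (x j)) = Rsum (fun a => h a * seq_type x a).
Proof.
have -> : Rsum (fun j => h (x j)) = Rsum (fun a => h a * INR (nocc x a)).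
  rewrite /Rsum (partition_big x predT) //=; apply: eq_bigr => a _.
  rewrite (eq_bigr (fun _ => h a)); last by move=> j /eqP ->.
  rewrite big_const /nocc; elim: #|_| => [|k IH]; first by rewrite Rmult_0_r.
  by rewrite S_INR iterS IH; ring.
rewrite -RsumZ; apply: Rsum_ext => a; rewrite /seq_type -/(nocc x a) /Rdiv; ring.
Qed.

End SeqType.

Lemma marginal_ge0 d n (mu : Xn d n -> R) i t :
  (forall x, 0 <= mu x) -> 0 <= marginal mu i t.
Proof. exact: Rsum_ge0_cond. Qed.

(** The types of [Xi N] match the marginals of [mu] only in the limit, so [mu] is shrunk by [1 - e]
    to fit below them before rounding down. Each letter then loses little frequency, and total mass
    1 prevents any letter from gaining much. *)
Lemma approximating_joint d n (mu : Xn d n -> R)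
    (Xi : forall N : nat, 'I_n -> {ffun 'I_N -> 'I_d}) delta :
  is_prob mu -> approximating mu Xi -> 0 < delta ->
  evt (fun N => exists sig : {ffun 'I_n -> 'S_N},
    forall a, Rabs (seq_type (perm_joint Xi sig) a - mu a) < delta).
Proof.
move=> [mu0 mu1] [_ Xicv] d0.
set K := INR #|Xn d n|; have K0 : 0 <= K by exact: pos_INR.
pose d1 := delta / (K + 1).
have d10 : 0 < d1 by apply: Rdiv_lt_0_compat; lra.
(* Half of the loss [d1] pays for the shrinking and half for the rounding; the bound [1 / 2] keeps
   [1 - e] positive. *)
pose e := Rmin (d1 / 2) (1 / 2).
have e0 : 0 < e by apply: Rmin_pos; lra.
have e1 : e <= d1 / 2 by exact: Rmin_l.
have e2 : e <= 1 / 2 by exact: Rmin_r.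
have mule a : mu a <= 1 by rewrite -mu1; exact: Rsum_ge_term.
have margs : evt (fun N => forall i t,
    (1 - e) * marginal mu i t <= seq_type (Xi N i) t).
  apply: evt_forall => i; apply: evt_forall => t.
  (* The room [e * marginal mu i t] vanishes with the marginal, but then the required bound is just
     nonnegativity. *)
  case: (marginal_ge0 i t mu0) => [m0|<-]; last first.
    by apply: evt_mono evt_gt0 => N N0; rewrite Rmult_0_r; exact: seq_type_ge0.
  apply: evt_mono (Un_cv_evt (Xicv i t) (Rmult_lt_0_compat _ _ e0 m0)) => N.
  by move/Rabs_def2; lra.
apply: evt_mono (evt_and margs (evt_and evt_gt0 (evt_INR_gt (2 / d1)))).
move=> N [marg [N0 Nbig]]; have rN := INR_gt0 N0.
have x0 a : 0 <= INR N * (1 - e) * mu a.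
  by apply: Rmult_le_pos => //; apply: Rmult_le_pos; lra.
pose k a := nfloor (INR N * (1 - e) * mu a).
have kP a : INR (k a) <= INR N * (1 - e) * mu a < INR (k a) + 1 by exact: nfloorP.
have kmarg i t : (\sum_(a : Xn d n | a i == t) k a <= nocc (Xi N i) t)%N.
  apply/leP/INR_le; rewrite INR_sum.
  apply: (Rle_trans _ (INR N * (1 - e) * marginal mu i t)).
    rewrite /marginal big_distrr /=; apply: Rsum_le_cond => a _.
    by have := kP a; lra.
  have := Rmult_le_compat_l (INR N) _ _ (Rlt_le _ _ rN) (marg i t).
  rewrite /seq_type -/(nocc (Xi N i) t).
  have -> : INR N * (INR (nocc (Xi N i) t) / INR N) = INR (nocc (Xi N i) t).
    by field; lra.
  lra.
have ktot : (\sum_a k a <= N)%N.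
  apply/leP/INR_le; rewrite INR_sum.
  apply: (Rle_trans _ (Rsum (fun a => INR N * (1 - e) * mu a))).
    by apply: Rsum_le => a; have := kP a; lra.
  rewrite RsumZ mu1; nra.
have [sig sigP] := perm_joint_dominating ktot kmarg; exists sig.
set nu := seq_type _.
have nuge a : mu a - d1 <= nu a.
  have : INR (k a) <= INR (nocc (perm_joint Xi sig) a) by exact: INR_leq.
  have -> : INR (nocc (perm_joint Xi sig) a) = INR N * nu a.
    by rewrite /nu /seq_type -/(nocc _ a); field; lra.
  move=> kn; have [_ k2] := kP a.
  have Nd : 1 < INR N * (d1 / 2).
    have -> : 1 = 2 / d1 * (d1 / 2) by field; lra.
    by apply: Rmult_lt_compat_r; lra.
  apply: (Rmult_le_reg_l (INR N)) => //.
  have h1 := mule a; have h2 := mu0 a.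
  have : INR N * (e * mu a) <= INR N * (d1 / 2) by apply: Rmult_le_compat_l; nra.
  lra.
(* The terms [nu a - mu a + d1] are nonnegative with sum [K * d1], since [nu] and [mu] have equal
   mass. *)
have nule a : nu a - mu a + d1 <= K * d1.
  have -> : K * d1 = Rsum (fun a => nu a - mu a + d1).
    by rewrite RsumD RsumB seq_type_sum // mu1 Rsum_const -/K; ring.
  apply: (Rsum_ge_term (F := fun a => nu a - mu a + d1)) => b.
  by have := nuge b; lra.
move=> a; have dE : delta = K * d1 + d1 by rewrite /d1; field; lra.
have := nuge a; have := nule a.
have := Rmult_le_pos _ _ K0 (Rlt_le _ _ d10).
have K1 : 1 <= K.
  by apply: (INR_leq (m := 1)); apply/card_gt0P; exists a.
by move=> *; apply: Rabs_def1; nra.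
Qed.

(** * Pressure and rate estimates *)

Section Estimates.
Variables (d n : nat) (Xi : forall N : nat, 'I_n -> {ffun 'I_N -> 'I_d}).
Implicit Types (mu h : Xn d n -> R) (N : nat).

Definition partition_fun h : R := Rsum (fun a => exp (h a)).

Definition l1norm h : R := Rsum (fun a => Rabs (h a)).

Definition type_entropies N : R := Rsum (fun i => entropy (seq_type (Xi N i))).

(** Reachable sequences are hit [stab_prod] times and the others never; extending the sum to all
    sequences makes it factorize for exponential weights. *)
Lemma sum_perm_joint_le N (F : {ffun 'I_N -> Xn d n} -> R) :
  (forall y, 0 <= F y) ->
  Rsum (fun sig => F (perm_joint Xi sig)) <= INR (stab_prod Xi N) * Rsum F.
Proof.
move=> F0; rewrite /Rsum (partition_big (@perm_joint d n Xi N) predT) //=.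
rewrite -RsumZ; apply: Rsum_le => y.
rewrite (eq_bigr (fun _ => F y)); last by move=> sig /eqP ->.
have -> : \big[Rplus/0]_(sig | perm_joint Xi sig == y) F y =
          INR #|[pred sig | perm_joint Xi sig == y]| * F y.
  rewrite big_const; elim: #|_| => [|k IH]; first by rewrite Rmult_0_l.
  by rewrite S_INR iterS IH; ring.
apply: Rmult_le_compat_r => //; apply: INR_leq.
by rewrite card_perm_joint_fiber; case: ifP.
Qed.

Lemma kappaE N h (y : {ffun 'I_N -> Xn d n}) : (0 < N)%N ->
  INR N * kappa h y = Rsum (fun j => h (y j)).
Proof. by move=> /INR_gt0 N0; rewrite /kappa -Rmult_assoc Rinv_r ?Rmult_1_l //; lra. Qed.

Lemma sum_exp_kappa N h : (0 < N)%N ->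
  Rsum (fun y : {ffun 'I_N -> Xn d n} => exp (INR N * kappa h y)) =
  partition_fun h ^ N.
Proof.
move=> N0; rewrite (Rsum_ext (G := fun y : {ffun 'I_N -> Xn d n} =>
  \big[Rmult/1]_j exp (h (y j)))); last first.
  by move=> y; rewrite kappaE // exp_sum.
rewrite /Rsum -(bigA_distr_bigA (fun _ a => exp (h a))) big_const card_ord.
by elim: N {N0} => //= N ->.
Qed.

Lemma ln_stab_prod N :
  ln (INR (stab_prod Xi N)) = Rsum (fun i => ln (INR (nstab (Xi N i)))).
Proof. by rewrite INR_ln_prod // => i; apply: nstab_gt0. Qed.

Lemma INR_fact_gt0 N : 0 < INR N`!.
Proof. exact: INR_gt0 (fact_gt0 N). Qed.

Lemma ln_fact_pow N : ln (INR N`! ^ n) = INR n * ln (INR N`!).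
Proof. by rewrite ln_pow //; exact: INR_fact_gt0. Qed.

(** Measures the exponential decay of [stab_prod / N!^n], the probability of a reachable joint
    sequence, by applying the Stirling estimate to each coordinate. *)
Lemma type_entropies_stab N : (0 < N)%N ->
  Rabs (/ INR N * (INR n * ln (INR N`!) - ln (INR (stab_prod Xi N)))
        - type_entropies N) <= INR n * stirling_err d N.
Proof.
move=> N0; rewrite ln_stab_prod.
have -> : INR n * ln (INR N`!) = Rsum (fun _ : 'I_n => ln (INR N`!)).
  by rewrite Rsum_const card_ord.
rewrite -RsumB -RsumZ -RsumB; apply: Rle_trans (Rsum_Rabs _) _.
have -> : INR n * stirling_err d N = Rsum (fun _ : 'I_n => stirling_err d N).
  by rewrite Rsum_const card_ord.
by apply: Rsum_le => i; have := ln_stab_entropy (Xi N i) N0; rewrite card_ord.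
Qed.

Lemma pressure_sum_gt0 N h :
  0 < Rsum (fun sig : {ffun 'I_n -> 'S_N} => exp (INR N * kappa h (perm_joint Xi sig))).
Proof.
apply: Rlt_le_trans
  (Rsum_ge_term (F := fun sig => exp (INR N * kappa h (perm_joint Xi sig)))
     [ffun=> 1%g] _); first exact: exp_pos.
by move=> sig; apply/Rlt_le/exp_pos.
Qed.

Lemma pressure_term_le N h : (0 < N)%N -> 0 < partition_fun h ->
  pressure_term Xi h N <=
  ln (partition_fun h) - type_entropies N + INR n * stirling_err d N.
Proof.
move=> N0 Z0; have rN := INR_gt0 N0.
have f0 : 0 < INR N`! ^ n by apply: pow_lt; exact: INR_fact_gt0.
have W0 : 0 < INR (stab_prod Xi N) by exact: INR_gt0 (stab_prod_gt0 Xi N).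
have ZN : 0 < partition_fun h ^ N by exact: pow_lt.
have := type_entropies_stab N0; set Q := / INR N * _ => QP.
have -> : ln (partition_fun h) - type_entropies N + INR n * stirling_err d N =
  / INR N * ln (/ INR N`! ^ n * (INR (stab_prod Xi N) * partition_fun h ^ N)) +
  (Q - type_entropies N + INR n * stirling_err d N).
  rewrite ln_mult; [|exact: Rinv_0_lt_compat|exact: Rmult_lt_0_compat].
  by rewrite ln_Rinv // ln_fact_pow ln_mult // ln_pow // /Q; field; lra.
suff : pressure_term Xi h N <=
    / INR N * ln (/ INR N`! ^ n * (INR (stab_prod Xi N) * partition_fun h ^ N)).
  by have := Rabs_le_inv QP; lra.
apply: Rmult_le_compat_l; first exact/Rlt_le/Rinv_0_lt_compat.
apply: ln_le.
  apply: Rmult_lt_0_compat; [exact: Rinv_0_lt_compat|exact: pressure_sum_gt0].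
apply: Rmult_le_compat_l; first exact/Rlt_le/Rinv_0_lt_compat.
rewrite -sum_exp_kappa //.
by apply: (sum_perm_joint_le (F := fun y => exp (INR N * kappa h y))) => y;
   apply/Rlt_le/exp_pos.
Qed.

Lemma seq_type_permute N (A : finType) (x : {ffun 'I_N -> A}) s a :
  seq_type (permute s x) a = seq_type x a.
Proof. by rewrite /seq_type -/(nocc (permute s x) a) nocc_permute. Qed.

Lemma rate_symE mu delta N : 0 < gamma_Delta_sym mu Xi N delta ->
  rate_sym mu Xi delta N = Fin (/ INR N * ln (gamma_Delta_sym mu Xi N delta)).
Proof. by move=> g0; rewrite /rate_sym /ERln /Rltb; case: Rlt_dec. Qed.

Lemma rate_sym_gt mu delta N (sig : {ffun 'I_n -> 'S_N}) b : (0 < N)%N ->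
  in_Delta mu delta (perm_joint Xi sig) ->
  b < entropy (seq_type (perm_joint Xi sig)) - stirling_err #|Xn d n| N
      - type_entropies N - INR n * stirling_err d N ->
  R_lt_ER b (rate_sym mu Xi delta N).
Proof.
move=> N0 inD blt; have rN := INR_gt0 N0.
have f0 : 0 < INR N`! ^ n by apply: pow_lt; exact: INR_fact_gt0.
have W0 : 0 < INR (stab_prod Xi N) by exact: INR_gt0 (stab_prod_gt0 Xi N).
have s0 : 0 < INR (nstab (perm_joint Xi sig)) by exact/INR_gt0/nstab_gt0.
have nf0 := INR_fact_gt0 N.
(* This is the probability of landing in the diagonal orbit of [perm_joint Xi sig], which stays in
   Delta because types are invariant under rearrangement. *)
pose g := INR (stab_prod Xi N) * INR N`! / INR (nstab (perm_joint Xi sig)) / INR N`! ^ n.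
have g0 : 0 < g.
  by do 2 (apply: Rdiv_lt_0_compat => //); exact: Rmult_lt_0_compat.
have gle : g <= gamma_Delta_sym mu Xi N delta.
  apply: Rmult_le_compat_r; first exact/Rlt_le/Rinv_0_lt_compat.
  apply: (Rmult_le_reg_r _ _ _ s0); rewrite /Rdiv Rmult_assoc Rinv_l; last lra.
  rewrite Rmult_1_r -!mult_INR; apply: INR_leq.
  apply: (card_perm_joint_orbit (P := fun y => in_Delta mu delta y)) => s.
  by apply/in_DeltaP => a; rewrite seq_type_permute; move/in_DeltaP: inD.
rewrite rate_symE /=; last lra.
apply: (Rlt_le_trans _ (/ INR N * ln g)); last first.
  by apply: Rmult_le_compat_l; [exact/Rlt_le/Rinv_0_lt_compat|exact: ln_le].
rewrite /g ln_div //; last by apply: Rdiv_lt_0_compat => //; exact: Rmult_lt_0_compat.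
rewrite ln_div //; last exact: Rmult_lt_0_compat.
rewrite ln_mult // ln_fact_pow.
have := Rabs_le_inv (type_entropies_stab N0).
have := Rabs_le_inv (ln_stab_entropy (perm_joint Xi sig) N0).
set e := stirling_err _ N; have -> : e = stirling_err #|Xn d n| N by [].
lra.
Qed.

Lemma kappa_ge mu delta N h (y : {ffun 'I_N -> Xn d n}) : in_Delta mu delta y ->
  expect mu h - delta * l1norm h <= kappa h y.
Proof.
move=> /in_DeltaP yD; rewrite /kappa kappa_seq_type /expect /l1norm -RsumZ -RsumB.
apply: Rsum_le => a.
have := Rle_abs (- (h a * (seq_type y a - mu a))).
rewrite Rabs_Ropp Rabs_mult.
have := Rmult_le_compat_l _ _ _ (Rabs_pos (h a)) (Rlt_le _ _ (yD a)).
lra.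
Qed.

(** Chebyshev's inequality: keep only the [sig] in Delta in the pressure sum, where [kappa h] is at
    least [mu(h) - delta * l1norm h]. *)
Lemma rate_le_pressure mu delta N h r : (0 < N)%N ->
  rate_sym mu Xi delta N = Fin r ->
  r + (expect mu h - delta * l1norm h) <= pressure_term Xi h N.
Proof.
move=> N0; have rN := INR_gt0 N0.
have f0 : 0 < INR N`! ^ n by apply: pow_lt; exact: INR_fact_gt0.
rewrite /rate_sym /ERln /Rltb; case: Rlt_dec => // g0 [<-].
set c := expect _ _ - _.
have -> : / INR N * ln (gamma_Delta_sym mu Xi N delta) + c =
  / INR N * ln (gamma_Delta_sym mu Xi N delta * exp (INR N * c)).
  by rewrite ln_mult //; [rewrite ln_exp; field; lra | exact: exp_pos].
apply: Rmult_le_compat_l; first exact/Rlt_le/Rinv_0_lt_compat.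
apply: ln_le; first by apply: Rmult_lt_0_compat => //; exact: exp_pos.
rewrite /gamma_Delta_sym /Rdiv [_ * / _]Rmult_comm Rmult_assoc.
apply: Rmult_le_compat_l; first exact/Rlt_le/Rinv_0_lt_compat.
set D := [pred sig | _].
have -> : INR #|D| * exp (INR N * c) = \big[Rplus/0]_(sig in D) exp (INR N * c).
  rewrite big_const; elim: #|_| => [|k IH]; first by rewrite Rmult_0_l.
  by rewrite S_INR iterS -IH; ring.
rewrite /Rsum [X in _ <= X](bigID (mem D)) /=.
rewrite -[X in X <= _]Rplus_0_r; apply: Rplus_le_compat; last first.
  by apply: Rsum_ge0_cond => sig; apply/Rlt_le/exp_pos.
apply: Rsum_le_cond => sig; rewrite inE => /(kappa_ge h) ck.
have [|->] := Rle_lt_or_eq_dec _ _ (Rmult_le_compat_l _ _ _ (Rlt_le _ _ rN) ck).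
  by move/exp_increasing/Rlt_le.
exact: Rle_refl.
Qed.

End Estimates.

(** * Asymptotics, near-optimal potentials and the two values *)

Section Limits.
Variables (d n : nat) (mu : Xn d n -> R).
Variable Xi : forall N : nat, 'I_n -> {ffun 'I_N -> 'I_d}.
Hypotheses (Hmu : is_prob mu) (HXi : approximating mu Xi).

Let G := Rsum (fun i : 'I_n => entropy (marginal mu i)).

Lemma type_entropies_cv eps : 0 < eps ->
  evt (fun N => Rabs (type_entropies Xi N - G) < eps).
Proof.
move=> e0; have n0 := pos_INR n; pose e1 := eps / (INR n + 1).
have e10 : 0 < e1 by apply: Rdiv_lt_0_compat; lra.
have H : evt (fun N => forall i,
    Rabs (entropy (seq_type (Xi N i)) - entropy (marginal mu i)) < e1).
  apply: evt_forall => i.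
  have [dl dP] := entropy_continuous (fun t => marginal_ge0 i t Hmu.1) e10.
  have Hcv : evt (fun N => forall t, Rabs (seq_type (Xi N i) t - marginal mu i t) < dl).
    by apply: evt_forall => t; apply: Un_cv_evt (cond_pos dl); exact: HXi.2.
  apply: evt_mono (evt_and evt_gt0 Hcv) => N [N0 HN]; apply: dP => // t.
  exact: seq_type_ge0.
apply: evt_mono H => N HN; rewrite /type_entropies /G -RsumB.
apply: Rle_lt_trans (Rsum_Rabs _) _.
apply: (Rle_lt_trans _ (Rsum (fun _ : 'I_n => e1))).
  by apply: Rsum_le => i; apply/Rlt_le/HN.
rewrite Rsum_const card_ord.
have -> : eps = INR n * e1 + e1 by rewrite /e1; field; lra.
lra.
Qed.

Lemma scaled_stirling_err_cv0 (c : R) a eps : 0 <= c -> 0 < eps ->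
  evt (fun N => c * stirling_err a N < eps).
Proof.
move=> c0 e0; have e1 : 0 < eps / (c + 1) by apply: Rdiv_lt_0_compat; lra.
apply: evt_mono (stirling_err_cv0 a e1) => N HN.
apply: (Rle_lt_trans _ (c * (eps / (c + 1)))).
  by apply: Rmult_le_compat_l; lra.
have -> : c * (eps / (c + 1)) = eps - eps / (c + 1) by field; lra.
lra.
Qed.

Lemma pressure_lt h eps : 0 < partition_fun h -> 0 < eps ->
  evt (fun N => pressure_term Xi h N < ln (partition_fun h) - G + eps).
Proof.
move=> Z0 e0; have e2 : 0 < eps / 2 by lra.
apply: evt_mono (evt_and evt_gt0 (evt_and (type_entropies_cv e2)
  (scaled_stirling_err_cv0 d (pos_INR n) e2))) => N [N0 [/Rabs_def2 HG He]].
have := pressure_term_le Xi N0 Z0; lra.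
Qed.

Lemma rate_gt delta eps : 0 < delta -> 0 < eps ->
  evt (fun N => R_lt_ER (entropy mu - G - eps) (rate_sym mu Xi delta N)).
Proof.
(* Four errors share [eps]: the entropy of the joint type, the marginal entropies, and two Stirling
   terms. *)
move=> d0 e0; have e4 : 0 < eps / 4 by lra.
have [dl dP] := entropy_continuous Hmu.1 e4.
have dl0 : 0 < Rmin delta dl by apply: Rmin_pos => //; exact: cond_pos.
apply: evt_mono (evt_and evt_gt0 (evt_and (approximating_joint Hmu HXi dl0)
  (evt_and (type_entropies_cv e4) (evt_and (stirling_err_cv0 #|Xn d n| e4)
  (scaled_stirling_err_cv0 d (pos_INR n) e4))))).
move=> N [N0 [[sig sigP] [/Rabs_def2 HG [He1 He2]]]].
apply: (rate_sym_gt (sig := sig)) => //.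
  by apply/in_DeltaP => a; apply: Rlt_le_trans (sigP a) _; exact: Rmin_l.
have /Rabs_def2 : Rabs (entropy (seq_type (perm_joint Xi sig)) - entropy mu) < eps / 4.
  apply: dP => a; first exact: seq_type_ge0.
  by apply: Rlt_le_trans (sigP a) _; exact: Rmin_r.
lra.
Qed.

Lemma pressure_gt h eps : 0 < eps ->
  evt (fun N => expect mu h + entropy mu - G - eps < pressure_term Xi h N).
Proof.
move=> e0; have l0 : 0 <= l1norm h by apply: Rsum_ge0 => a; exact: Rabs_pos.
(* The [+ 1] avoids a zero denominator and gives [dl * l1norm h < eps / 2]. *)
pose dl := eps / 2 / (l1norm h + 1).
have dl0 : 0 < dl by apply: Rdiv_lt_0_compat; lra.
have e2 : 0 < eps / 2 by lra.
apply: evt_mono (evt_and evt_gt0 (rate_gt dl0 e2)) => N [N0].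
case E : (rate_sym mu Xi dl N) => [r|] //= rlt.
have := rate_le_pressure h N0 E.
have -> : dl * l1norm h = eps / 2 - dl by rewrite /dl; field; lra.
lra.
Qed.

Lemma Psym_exists h : 0 < partition_fun h -> exists P, Psym_is Xi h P.
Proof.
move=> Z0.
apply: (limsup_exists (u := fun N => Fin (pressure_term Xi h N))
  (pressure_lt Z0 Rlt_0_1)).
exact: evt_often (pressure_gt h Rlt_0_1).
Qed.

Lemma Psym_le h P : Psym_is Xi h P -> 0 < partition_fun h ->
  P <= ln (partition_fun h) - G.
Proof.
move=> HP Z0; apply: Rle_plus_epsilon => eps e0.
exact: limsup_le HP (pressure_lt Z0 e0).
Qed.

Lemma Psym_ge h P : Psym_is Xi h P -> expect mu h + entropy mu - G <= P.
Proof.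
move=> HP; apply: Rle_plus_epsilon => eps e0.
by have := limsup_ge HP (pressure_gt h e0); lra.
Qed.

(* [mu] may vanish somewhere, so [ln mu] itself is not an admissible potential. *)
Definition mix_potential (t : R) (a : Xn d n) : R :=
  ln ((1 - t) * mu a + t / INR #|Xn d n|).

Lemma mix_gt0 t a : 0 < t < 1 -> 0 < (1 - t) * mu a + t / INR #|Xn d n|.
Proof.
move=> t01; have m0 := Hmu.1 a.
have : 0 < t / INR #|Xn d n|.
  by apply: Rdiv_lt_0_compat; [lra | apply/INR_gt0/card_gt0P; exists a].
have := Rmult_le_pos (1 - t) (mu a); lra.
Qed.

(** The exponential of the potential is itself a probability vector, so the logarithmic term in the
    pressure bound disappears. *)
Lemma partition_mix t : 0 < t < 1 -> partition_fun (mix_potential t) = 1.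
Proof.
move=> t01; rewrite /partition_fun.
rewrite (Rsum_ext (G := fun a => (1 - t) * mu a + t / INR #|Xn d n|)); last first.
  by move=> a; rewrite exp_ln //; exact: mix_gt0.
rewrite RsumD RsumZ Hmu.2.
have -> : Rsum (fun _ : Xn d n => t / INR #|Xn d n|) =
          INR #|Xn d n| * (t / INR #|Xn d n|) by exact: Rsum_const.
(* The alphabet cannot be empty, because [mu] has mass 1. *)
have K0 : (0 < #|Xn d n|)%N.
  rewrite lt0n; apply/eqP => /card0_eq K0.
  have := Hmu.2; rewrite /Rsum big_pred0; first lra.
  by move=> a; have := K0 a; rewrite !inE.
by field; have := INR_gt0 K0; lra.
Qed.

(** Where [mu] is positive, dropping the uniform part lowers the potential to [ln mu + ln (1 - t)];
    where it vanishes, both sides contribute 0. *)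
Lemma expect_mix t : 0 < t < 1 ->
  - entropy mu + ln (1 - t) <= expect mu (mix_potential t).
Proof.
move=> t01; rewrite /entropy /expect Ropp_involutive.
have -> : ln (1 - t) = Rsum (fun a => ln (1 - t) * mu a) by rewrite RsumZ Hmu.2 Rmult_1_r.
rewrite -RsumD; apply: Rsum_le => a.
case: (Hmu.1 a) => [m0|<-]; last lra.
have K0 : 0 < t / INR #|Xn d n|.
  by apply: Rdiv_lt_0_compat; [lra | apply/INR_gt0/card_gt0P; exists a].
have : ln ((1 - t) * mu a) <= mix_potential t a.
  by apply: ln_le; [apply: Rmult_lt_0_compat|]; lra.
rewrite ln_mult //; last lra.
move=> H; have := Rmult_le_compat_r _ _ _ (Rlt_le _ _ m0) H; lra.
Qed.

Lemma ln_1sub_small eps : 0 < eps -> exists t, 0 < t < 1 /\ - eps <= ln (1 - t).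
Proof.
move=> e0; exists (1 - exp (- eps)).
have := exp_pos (- eps).
have : exp (- eps) < 1 by rewrite -exp_0; apply: exp_increasing; lra.
have -> : 1 - (1 - exp (- eps)) = exp (- eps) by ring.
rewrite ln_exp; lra.
Qed.

(** [Psym_ge] bounds every competitor, and [mix_potential t] comes within [- ln (1 - t)] of that
    bound. *)
Lemma calIsym_value : calIsym_is mu Xi (- entropy mu + G).
Proof.
split=> [y [h [P [HP ->]]]|b bP]; first by have := Psym_ge HP; lra.
apply: Rle_plus_epsilon => eps /ln_1sub_small[t [t01 lt]].
have Z := partition_mix t01.
have Z0 : 0 < partition_fun (mix_potential t) by lra.
have [P HP] := Psym_exists Z0.
have := bP _ (ex_intro _ _ (ex_intro _ _ (conj HP erefl))).
have := Psym_le HP Z0; rewrite Z ln_1; have := expect_mix t01; lra.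
Qed.

Lemma Isym_value : Isym_is mu Xi (- entropy mu + G).
Proof.
move=> eps e0; have e4 : 0 < eps / 4 by lra.
have [t [t01 lt]] := ln_1sub_small e4.
set h := mix_potential t.
have Z : partition_fun h = 1 by exact: partition_mix.
have Z0 : 0 < partition_fun h by lra.
have l0 : 0 <= l1norm h by apply: Rsum_ge0 => a; exact: Rabs_pos.
(* The potential is fixed before [delta], so that its norm limits the radius. The upper bound then
   loses three times [eps / 4]: from the pressure, the mixing and the radius. *)
pose eta := eps / 4 / (l1norm h + 1).
have eta0 : 0 < eta by apply: Rdiv_lt_0_compat; lra.
exists eta; split=> // delta [d0 dlt].
have dl : delta * l1norm h <= eps / 4.
  have -> : eps / 4 = eta * (l1norm h + 1) by rewrite /eta; field; lra.
  nra.
have up : evt (fun N => ER_lt_R (rate_sym mu Xi delta N) (entropy mu - G + 3 * eps / 4)).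
  apply: evt_mono (evt_and evt_gt0 (pressure_lt Z0 e4)) => N [N0].
  rewrite Z ln_1; case E : (rate_sym mu Xi delta N) => [r|] //= plt.
  have := rate_le_pressure h N0 E; have := expect_mix t01; rewrite -/h; lra.
have [L HL] := limsup_exists up (evt_often (rate_gt d0 e0)).
exists L; split=> //.
have Lle := limsup_le HL up.
(* This side holds for every positive [delta], with arbitrarily small error. *)
have Lge : entropy mu - G <= L.
  apply: Rle_plus_epsilon => e e1; have := limsup_ge HL (rate_gt d0 e1); lra.
by apply: Rabs_def1; lra.
Qed.

End Limits.

Theorem theorem4p5 (d n : nat) (mu : Xn d n -> R) (Hmu : is_prob mu)
  (Xi : forall N : nat, 'I_n -> {ffun 'I_N -> 'I_d})
  (HXi : approximating mu Xi) :
  calIsym_is mu Xi (- entropy mu + Rsum (fun i : 'I_n => entropy (marginal mu i))) /\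
  Isym_is mu Xi (- entropy mu + Rsum (fun i : 'I_n => entropy (marginal mu i))).
Proof. by split; [exact: calIsym_value | exact: Isym_value]. Qed.
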